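(* Fix $n\in\mathbb{N}$, let $e(n)=2^{2^n}$, and let $\mathcal F,\mathcal C,\mathcal D$ be as in the context. Let $\preccurlyeq$ be any monomial ordering on the monomials in $\mathbb{X}$ such that (i) for every $\alpha\in\mathcal C$, $s\prec\alpha$; and (ii) for every $g\in\mathcal D$, if $f\in\mathrm{IdealRes}_{\mathcal F}(g)$, then $g\preccurlyeq f$. Then $|\mathrm{Gb}_{\preccurlyeq}(\mathcal F)|\ge e(n)$ and $|\{p\in\mathrm{Gb}_{\preccurlyeq}(\mathcal F):\deg(p)\ge e(n)\}|\ge e(n)$.
   Context: $\mathbb{Z}_2$ is the field with two elements. $\mathbb{X}$ is the finite set of distinct variables $\{s,\ell,c,\bar c,b,\bar b\}\cup\bigcup_{i=0}^n(V_i\cup\bar V_i)$, where $V_i=\{s_i,f_i,q_{1i},\dots,q_{4i},c_{1i},\dots,c_{4i},b_{1i},\dots,b_{4i}\}$ and $\bar V_i=\{\bar s_i,\bar f_i,\bar q_{ki},\bar c_{ki},\bar b_{ki}: k\in\{1,2,3,4\}\}$ (barred variables are new variables). Let $\mathcal P=\bigcup_{m=0}^{n}\mathcal P_m$, where $\mathcal P_0=\{b_{i0}^2c_{i0}f_0+c_{i0}s_0 : i\in\{1,2,3,4\}\}$ and, for $1\le m\le n$, $\mathcal P_m$ consists of $q_{1m}c_{1(m-1)}s_{m-1}+s_m$; $q_{2m}c_{2(m-1)}s_{m-1}+q_{1m}b_{1(m-1)}c_{1(m-1)}f_{m-1}$; $q_{3m}c_{3(m-1)}f_{m-1}+q_{2m}c_{2(m-1)}f_{m-1}$;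 $q_{3m}b_{1(m-1)}c_{3(m-1)}s_{m-1}+q_{2m}b_{4(m-1)}c_{2(m-1)}s_{m-1}$; $q_{4m}b_{4(m-1)}c_{4(m-1)}f_{m-1}+q_{3m}c_{3(m-1)}s_{m-1}$; $q_{4m}c_{4(m-1)}s_{m-1}+f_m$; and $q_{2m}b_{3(m-1)}b_{im}c_{im}f_{m-1}+q_{2m}b_{2(m-1)}c_{im}f_{m-1}$ for $i\in\{1,2,3,4\}$. Let $\bar{\mathcal P}$ be obtained from $\mathcal P$ by replacing every variable $s_i,f_i,q_{ki},c_{ki},b_{ki}$ by $\bar s_i,\bar f_i,\bar q_{ki},\bar c_{ki},\bar b_{ki}$. Let $\mathcal G=\{b_{4n}\ell b+\ell c,\ b_{4n}\ell\bar b+\ell\bar c,\ c_{4n}f_n+\ell,\ \bar c_{4n}\bar f_n+c_{4n}s_n,\ \bar b_{4n}c_{4n}s_n+c_{4n}s_nb,\ \bar b_{4n}c_{4n}s_n+c_{4n}s_n\bar b,\ \bar c_{4n}\bar s_n+s\}$ and $\mathcal F=\mathcal P\cup\bar{\mathcal P}\cup\mathcal G$. Let $\mathcal C=\{\ell\bar c^{m_1}c^{m_2}: m_1,m_2\ge 0,\ m_1+m_2=e(n)\}$ and $\mathcal D=\{\ell^j\bar c^{m_1}c^{m_2}: j\in\{0,1\},\ m_1,m_2\ge 0,\ j+m_1+m_2\le e(n)\}$. A monomial ordering is a total order $\preccurlyeq$ on monomials with $1\preccurlyeq t$ for all $t$ and $t_1\preccurlyeq t_2\Rightarrow t_1t_3\preccurlyeq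 t_2t_3$. It is extended to polynomials in $\mathbb{Z}_2[\mathbb{X}]$ by: $g\preccurlyeq f$ iff $g=f$, or the highest monomial of $g$ is strictly below the highest monomial of $f$, or they have the same highest monomial $t$ and $g-t\preccurlyeq f-t$ (recursively; the zero polynomial is below every nonzero polynomial). For $g\in\mathbb{Z}_2[\mathbb{X}]$, $\mathrm{IdealRes}_{\mathcal F}(g)=\{h\in\mathbb{Z}_2[\mathbb{X}]: g+h\in\langle\mathcal F\rangle\}$, where $\langle\mathcal F\rangle$ is the ideal generated by $\mathcal F$. $\mathrm{Gb}_{\preccurlyeq}(\mathcal F)$ denotes the reduced Gröbner basis of $\langle\mathcal F\rangle$ w.r.t. $\preccurlyeq$; the degree of a polynomial is the maximum total degree of its monomials. *)

(* Defs.v *)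
From HB Require Import structures.
From mathcomp Require Import all_boot all_order all_algebra.
From mathcomp Require Import finmap.
From mathcomp Require Import mpoly.
Set Implicit Arguments.
Unset Strict Implicit.
Unset Printing Implicit Defensive.
Import GRing.Theory.
Local Open Scope ring_scope.

Record monomial_ordering (N : nat) (le : rel 'X_{1..N}) : Prop :=
  MonomialOrdering {
    mo_refl : reflexive le;
    mo_anti : antisymmetric le;
    mo_trans : transitive le;
    mo_total : total le;
    mo_one : forall t : 'X_{1..N}, le 0%MM t;
    mo_mul : forall t1 t2 t3 : 'X_{1..N},
      le t1 t2 -> le (t1 + t3)%MM (t2 + t3)%MM
  }.

Definition mon_lt (N : nat) (le : rel 'X_{1..N}) : rel 'X_{1..N} :=
  fun t1 t2 => (t1 != t2) && le t1 t2.

(** [mlead] of the library is tied to degrevlex, hence this relational version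
    for an arbitrary ordering; it fails for every [t] when [p = 0]. *)
Definition is_highest (N : nat) (le : rel 'X_{1..N})
    (p : {mpoly 'F_2[N]}) (t : 'X_{1..N}) : Prop :=
  t \in msupp p /\ forall t' : 'X_{1..N}, t' \in msupp p -> le t' t.

Inductive poly_le (N : nat) (le : rel 'X_{1..N}) :
    {mpoly 'F_2[N]} -> {mpoly 'F_2[N]} -> Prop :=
  | PolyLeRefl f : poly_le le f f
  | PolyLeZero f : f != 0 -> poly_le le 0 f
  | PolyLeLead g f tg tf :
      is_highest le g tg -> is_highest le f tf -> mon_lt le tg tf ->
      poly_le le g f
  | PolyLeTail g f t :
      is_highest le g t -> is_highest le f t ->
      poly_le le (g - 'X_[t]) (f - 'X_[t]) -> poly_le le g f.

Definition in_ideal (N : nat) (F : seq {mpoly 'F_2[N]})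
    (p : {mpoly 'F_2[N]}) : Prop :=
  exists a : 'I_(size F) -> {mpoly 'F_2[N]},
    p = \sum_(i < size F) a i * F`_i.

Definition IdealRes (N : nat) (F : seq {mpoly 'F_2[N]})
    (g h : {mpoly 'F_2[N]}) : Prop :=
  in_ideal F (g + h).

Definition total_degree (N : nat) (p : {mpoly 'F_2[N]}) : nat :=
  \max_(t <- msupp p) mdeg t.

Definition is_groebner_basis (N : nat) (le : rel 'X_{1..N})
    (F : seq {mpoly 'F_2[N]}) (G : {fset {mpoly 'F_2[N]}}) : Prop :=
  (forall p, p \in G -> in_ideal F p /\ p != 0) /\
  (forall f tf, in_ideal F f -> is_highest le f tf ->
     exists p tp, [/\ p \in G, is_highest le p tp & (tp <= tf)%MM]).

(** Leading coefficients are automatically 1 over Z_2, so reducedness only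
    asks that no monomial of an element be divisible by the highest monomial
    of another element. *)
Definition is_reduced_groebner_basis (N : nat) (le : rel 'X_{1..N})
    (F : seq {mpoly 'F_2[N]}) (G : {fset {mpoly 'F_2[N]}}) : Prop :=
  is_groebner_basis le F G /\
  (forall p q t tq, p \in G -> q \in G -> p != q ->
     t \in msupp p -> is_highest le q tq -> ~~ (tq <= t)%MM).

(** The boolean of a global or of an indexed variable is [true]
    for the barred copy.  Indices k in {1,2,3,4} are represented by ['I_4],
    shifted by one. *)

Inductive global_var := Xs | Xl | Xc of bool | Xb of bool.

Definition global_var_enc (v : global_var) : bool + bool + bool :=
  match v with
  | Xs => inl (inl false) | Xl => inl (inl true)
  | Xc bar => inl (inr bar) | Xb bar => inr bar
  end.

Definition global_var_dec (x : bool + bool + bool) : global_var :=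
  match x with
  | inl (inl false) => Xs | inl (inl true) => Xl
  | inl (inr bar) => Xc bar | inr bar => Xb bar
  end.

Lemma global_var_encK : cancel global_var_enc global_var_dec.
Proof. by case. Qed.

HB.instance Definition _ := Finite.copy global_var (can_type global_var_encK).

Inductive level_var := Ls | Lf | Lq of 'I_4 | Lc of 'I_4 | Lb of 'I_4.

Definition level_var_enc (v : level_var) : bool + 'I_4 + 'I_4 + 'I_4 :=
  match v with
  | Ls => inl (inl (inl false)) | Lf => inl (inl (inl true))
  | Lq k => inl (inl (inr k)) | Lc k => inl (inr k) | Lb k => inr k
  end.

Definition level_var_dec (x : bool + 'I_4 + 'I_4 + 'I_4) : level_var :=
  match x with
  | inl (inl (inl false)) => Ls | inl (inl (inl true)) => Lf
  | inl (inl (inr k)) => Lq k | inl (inr k) => Lc k | inr k => Lb k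
  end.

Lemma level_var_encK : cancel level_var_enc level_var_dec.
Proof. by case. Qed.

HB.instance Definition _ := Finite.copy level_var (can_type level_var_encK).

(** An indexed variable is (barred?, level i <= n, name). *)
Definition XX (n : nat) : finType :=
  (global_var + bool * 'I_n.+1 * level_var)%type.

Definition nvars (n : nat) : nat := #|XX n|.

Definition gidx (n : nat) (v : global_var) : 'I_(nvars n) :=
  enum_rank (inl v : XX n).

(** The level is a plain number; it must be at most [n], as it always is
    below ([inord] sends larger ones to 0). *)
Definition lidx (n : nat) (bar : bool) (v : level_var) (i : nat) :
    'I_(nvars n) :=
  enum_rank (inr (bar, inord i, v) : XX n).

Definition gvar (n : nat) (v : global_var) : {mpoly 'F_2[nvars n]} :=
  'X_(gidx n v).

Definition lvar (n : nat) (bar : bool) (v : level_var) (i : nat) :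
    {mpoly 'F_2[nvars n]} :=
  'X_(lidx n bar v i).

Definition k1 : 'I_4 := @Ordinal 4 0 isT.
Definition k2 : 'I_4 := @Ordinal 4 1 isT.
Definition k3 : 'I_4 := @Ordinal 4 2 isT.
Definition k4 : 'I_4 := @Ordinal 4 3 isT.

Definition e (n : nat) : nat := (2 ^ (2 ^ n))%N.

Definition P_zero (n : nat) (bar : bool) : seq {mpoly 'F_2[nvars n]} :=
  let s := lvar n bar Ls in
  let f := lvar n bar Lf in
  let c k := lvar n bar (Lc k) in
  let b k := lvar n bar (Lb k) in
  [seq b i 0%N ^+ 2 * c i 0%N * f 0%N + c i 0%N * s 0%N
  | i <- [:: k1; k2; k3; k4]].

(** For [1 <= m]. *)
Definition P_pos (n : nat) (bar : bool) (m : nat) :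
    seq {mpoly 'F_2[nvars n]} :=
  let s := lvar n bar Ls in
  let f := lvar n bar Lf in
  let q k := lvar n bar (Lq k) in
  let c k := lvar n bar (Lc k) in
  let b k := lvar n bar (Lb k) in
  let p := m.-1 in
  [:: q k1 m * c k1 p * s p + s m;
      q k2 m * c k2 p * s p + q k1 m * b k1 p * c k1 p * f p;
      q k3 m * c k3 p * f p + q k2 m * c k2 p * f p;
      q k3 m * b k1 p * c k3 p * s p + q k2 m * b k4 p * c k2 p * s p;
      q k4 m * b k4 p * c k4 p * f p + q k3 m * c k3 p * s p;
      q k4 m * c k4 p * s p + f m]
  ++ [seq q k2 m * b k3 p * b i m * c i m * f p + q k2 m * b k2 p * c i m * f p
     | i <- [:: k1; k2; k3; k4]].

(** [PP n false] is P and [PP n true] is its barred copy. *)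
Definition PP (n : nat) (bar : bool) : seq {mpoly 'F_2[nvars n]} :=
  P_zero n bar ++ flatten [seq P_pos n bar m | m <- iota 1 n].

Definition GG (n : nat) : seq {mpoly 'F_2[nvars n]} :=
  let s := gvar n Xs in
  let l := gvar n Xl in
  let c := gvar n (Xc false) in
  let c' := gvar n (Xc true) in
  let b := gvar n (Xb false) in
  let b' := gvar n (Xb true) in
  let sn bar := lvar n bar Ls n in
  let fn bar := lvar n bar Lf n in
  let c4n bar := lvar n bar (Lc k4) n in
  let b4n bar := lvar n bar (Lb k4) n in
  [:: b4n false * l * b + l * c;
      b4n false * l * b' + l * c';
      c4n false * fn false + l;
      c4n true * fn true + c4n false * sn false;
      b4n true * c4n false * sn false + c4n false * sn false * b;
      b4n true * c4n false * sn false + c4n false * sn false * b';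
      c4n true * sn true + s].

Definition FF (n : nat) : seq {mpoly 'F_2[nvars n]} :=
  PP n false ++ PP n true ++ GG n.

(** The exponent vector of l^j * cbar^m1 * c^m2. *)
Definition lcc_mon (n j m1 m2 : nat) : 'X_{1..nvars n} :=
  (U_(gidx n Xl) *+ j + U_(gidx n (Xc true)) *+ m1
     + U_(gidx n (Xc false)) *+ m2)%MM.

Definition in_CC (n : nat) (t : 'X_{1..nvars n}) : Prop :=
  exists m1 m2 : nat, (m1 + m2 = e n)%N /\ t = lcc_mon n 1 m1 m2.

Definition in_DD (n : nat) (t : 'X_{1..nvars n}) : Prop :=
  exists j m1 m2 : nat,
    [/\ (j <= 1)%N, (j + m1 + m2 <= e n)%N & t = lcc_mon n j m1 m2].

(* Main.v *)
Require Import Defs.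
From mathcomp Require Import all_boot all_order all_algebra.
From mathcomp Require Import finmap.
From mathcomp Require Import mpoly.
From mathcomp Require Import zify ring.

(** Each generator is a binomial [u + v], read as a rule [u = v] modulo the
    ideal.  The rules of level [m] run those of level [m - 1] inside a loop of
    length [e (m - 1)], which turns [c s = b^d c f] with [d = e (m - 1)] into
    the same relation with [d^2 = e m]; the rules of [GG] then give [s = t]
    for every [t] in [C].  By (i) the highest monomial of [t + s] is [t], so
    some element [p] of the basis has its highest monomial [u] dividing [t].
    If [u != t] then [u] lies in [D], and (ii) applied to [u] and its residue
    [p - u], all of whose monomials are below [u], is contradictory.  So every
    [t] in [C] is the highest monomial of an element of the basis. *)

Set Implicit Arguments.
Unset Strict Implicit.
Unset Printing Implicit Defensive.
Import GRing.Theory.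
Local Open Scope ring_scope.

(** * Rewriting in a commutative ring modulo a multiplicative congruence *)

Record mul_congruence (R : comNzRingType) (E : R -> R -> Prop) : Prop :=
  MulCongruence {
    mc_refl : forall x, E x x;
    mc_sym : forall x y, E x y -> E y x;
    mc_trans : forall x y z, E x y -> E y z -> E x z;
    mc_mul : forall w x y, E x y -> E (w * x) (w * y)
  }.

Lemma mc_step (R : comNzRingType) (E : R -> R -> Prop) (w u v x y z : R) :
  mul_congruence E -> E u v -> x = w * u -> y = w * v -> E y z -> E x z.
Proof.
by move=> cE Euv -> ->; apply: (mc_trans cE); apply: (mc_mul cE).
Qed.

(** The factor [x] is a catalyst: trading [u] for [v] leaves it in place for the next round. *)
Lemma mc_iter (R : comNzRingType) (E : R -> R -> Prop) (u v x : R) (k : nat) :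
  mul_congruence E -> E (u * x) (v * x) -> E (u ^+ k * x) (v ^+ k * x).
Proof.
move=> cE Euv; elim: k => [|k IHk]; first by rewrite !expr0; apply: (mc_refl cE).
apply: (mc_step (w := u) cE IHk); rewrite ?exprS; [ring|reflexivity|].
by apply: (mc_step (w := v ^+ k) cE Euv); last apply: (mc_refl cE); ring.
Qed.

(** A counting loop with states [q k1] to [q k4]: the factors [b k1] count the passes, and each of
    the [d] passes contributes [B ^+ d]. *)
Lemma mc_square_exponent (R : comNzRingType) (E : R -> R -> Prop)
    (s f s' f' B C : R) (q c b : 'I_4 -> R) (d : nat) :
  mul_congruence E -> (0 < d)%N ->
  (forall k, E (c k * s) (b k ^+ d * c k * f)) ->
  E (q k1 * c k1 * s) s' ->
  E (q k2 * c k2 * s) (q k1 * b k1 * c k1 * f) ->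
  E (q k3 * c k3 * f) (q k2 * c k2 * f) ->
  E (q k3 * b k1 * c k3 * s) (q k2 * b k4 * c k2 * s) ->
  E (q k4 * b k4 * c k4 * f) (q k3 * c k3 * s) ->
  E (q k4 * c k4 * s) f' ->
  E (q k2 * b k3 * B * C * f) (q k2 * b k2 * C * f) ->
  E (C * s') (B ^+ (d * d) * C * f').
Proof.
case: d => // d cE _ Elow R1 R2 R3 R4 R5 R6 R7; have sE := mc_sym cE.
(* One pass: [c k2 * s] releases [b k2 ^+ d.+1], [R7] turns each [b k2] into [b k3 * B], [R3]
   switches the state, and the relation for [k3] read backwards absorbs the [b k3]. *)
have pass k j : E (C * q k2 * b k1 ^+ j * b k4 ^+ k * B ^+ (k * d.+1) * c k2 * s)
    (C * q k3 * b k1 ^+ j * b k4 ^+ k * B ^+ (k.+1 * d.+1) * c k3 * s).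
  set w := b k1 ^+ j * b k4 ^+ k.
  have R7i : E (b k2 ^+ d.+1 * (q k2 * C * f))
               ((b k3 * B) ^+ d.+1 * (q k2 * C * f)).
    apply: (mc_iter _ cE); apply: sE.
    by apply: (mc_step (w := 1) cE R7); last apply: (mc_refl cE); ring.
  rewrite mulSn exprD.
  apply: (mc_step (w := C * q k2 * w * B ^+ (k * d.+1)) cE (Elow k2));
    [by rewrite /w; ring | reflexivity |].
  apply: (mc_step (w := w * B ^+ (k * d.+1) * c k2) cE R7i);
    [by ring | reflexivity |].
  rewrite exprMn.
  apply: (mc_step (w := C * w * B ^+ d.+1 * B ^+ (k * d.+1) * b k3 ^+ d.+1)
    cE (sE _ _ R3)); [by ring | reflexivity |].
  apply: (mc_step (w := C * q k3 * w * B ^+ d.+1 * B ^+ (k * d.+1))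
    cE (sE _ _ (Elow k3))); [by ring | reflexivity |].
  by rewrite /w; apply: eq_ind (mc_refl cE _) _ _; ring.
(* Each return by [R4] trades a [b k1] for a [b k4], so [k] returns go with [k.+1] passes. *)
have loop k : (k <= d)%N -> E (C * q k2 * b k1 ^+ d * c k2 * s)
    (C * q k3 * b k1 ^+ (d - k) * b k4 ^+ k * B ^+ (k.+1 * d.+1) * c k3 * s).
  elim: k => [_|k IHk lt_kd].
    by have := pass 0%N d; rewrite mul0n !expr0 !mulr1 subn0.
  apply: (mc_trans cE (IHk (ltnW lt_kd))).
  apply: (mc_trans cE _ (pass _ _)).
  rewrite [b k1 ^+ (d - k)](_ : _ = b k1 * b k1 ^+ (d - k.+1)).
    apply: (mc_step (w := C * b k1 ^+ (d - k.+1) * b k4 ^+ k *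
      B ^+ (k.+1 * d.+1)) cE R4); [by ring | reflexivity |].
    by rewrite [b k4 ^+ k.+1]exprS; apply: eq_ind (mc_refl cE _) _ _; ring.
  by rewrite -exprS subnSK.
apply: (mc_step (w := C) cE (sE _ _ R1)) => //.
apply: (mc_step (w := C * q k1) cE (Elow k1)); [by ring | reflexivity |].
(* Entering the loop spends one of the [d.+1] factors [b k1], which leaves [d] returns; the exit by
   [R5] supplies the missing last [b k4]. *)
apply: (mc_step (w := C * b k1 ^+ d) cE (sE _ _ R2));
  [by rewrite exprS; ring | reflexivity |].
apply: (mc_step (w := 1) cE (loop d (leqnn d))); [by ring | reflexivity |].
rewrite subnn expr0.
apply: (mc_step (w := C * b k4 ^+ d * B ^+ (d.+1 * d.+1)) cE (sE _ _ R5));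
  [by ring | reflexivity |].
apply: (mc_step (w := C * q k4 * B ^+ (d.+1 * d.+1)) cE (sE _ _ (Elow k4)));
  [by rewrite exprS; ring | reflexivity |].
apply: (mc_step (w := C * B ^+ (d.+1 * d.+1)) cE R6); [by ring | reflexivity |].
by apply: eq_ind (mc_refl cE _) _ _; ring.
Qed.

(** * Congruence modulo an ideal over the field with two elements *)

Lemma mpolyF2_addxx (N : nat) (p : {mpoly 'F_2[N]}) : p + p = 0.
Proof.
apply/mpolyP => t; rewrite mcoeffD mcoeff0.
by case: (p@_t) => [[|[|]]] // ?; apply/val_inj.
Qed.

Lemma in_ideal_gen (N : nat) (F : seq {mpoly 'F_2[N]}) (p : {mpoly 'F_2[N]}) :
  p \in F -> in_ideal F p.
Proof.
move=> pF; have lt_pF : (index p F < size F)%N by rewrite index_mem.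
exists (fun i => (i == Ordinal lt_pF)%:R).
rewrite (bigD1 (Ordinal lt_pF)) //= eqxx mul1r nth_index // big1 ?addr0 //.
by move=> i /negbTE->; rewrite mul0r.
Qed.

(** In characteristic 2 a sum is also a difference, so [IdealRes] is ordinary congruence modulo the
    ideal. *)
Lemma ideal_congruence (N : nat) (F : seq {mpoly 'F_2[N]}) :
  mul_congruence (IdealRes F).
Proof.
split=> [x|x y|x y z [a xy] [b yz]|w x y [a xy]]; rewrite /IdealRes.
- exists (fun=> 0); rewrite mpolyF2_addxx big1 // => i _; exact: mul0r.
- by rewrite addrC.
- exists (fun i => a i + b i).
  under eq_bigr do rewrite mulrDl.
  by rewrite big_split /= -xy -yz addrA -(addrA x) mpolyF2_addxx addr0.
- exists (fun i => w * a i); under eq_bigr do rewrite -mulrA.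
  by rewrite -mulr_sumr -xy mulrDr.
Qed.

Lemma e_gt0 (n : nat) : (0 < e n)%N.
Proof. by rewrite expn_gt0. Qed.

Lemma eS (n : nat) : e n.+1 = (e n * e n)%N.
Proof. by rewrite /e expnS mul2n -addnn expnD. Qed.

Lemma PP_FF (n : nat) (bar : bool) (p : {mpoly 'F_2[nvars n]}) :
  p \in PP n bar -> p \in FF n.
Proof. by rewrite !mem_cat; case: bar => ->; rewrite ?orbT. Qed.

(** Induction on the level: each loop squares the exponent, as does passing from [e m] to
    [e m.+1]. *)
Lemma level_relation (n : nat) (bar : bool) (m : nat) (k : 'I_4) :
  (m <= n)%N ->
  IdealRes (FF n) (lvar n bar (Lc k) m * lvar n bar Ls m)
    (lvar n bar (Lb k) m ^+ e m * lvar n bar (Lc k) m * lvar n bar Lf m).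
Proof.
have k4E (i : 'I_4) : i \in [:: k1; k2; k3; k4].
  by case: i => [[|[|[|[|]]]]].
elim: m k => [|m IHm] k lt_mn.
  (* The generator of level zero has exponent 2, which is [e 0], and its terms in the opposite
     order. *)
  apply: (mc_sym (ideal_congruence _)); apply: in_ideal_gen; apply: (@PP_FF n bar).
  by rewrite mem_cat; apply/orP; left; apply/mapP; exists k.
have P_FF p : p \in P_pos n bar m.+1 -> in_ideal (FF n) p.
  move=> pP; apply: in_ideal_gen; apply: (@PP_FF n bar).
  rewrite mem_cat; apply/orP; right; apply/flattenP.
  by exists (P_pos n bar m.+1) => //; apply: map_f; rewrite mem_iota; lia.
have P_FFn i : (i < 10)%N -> in_ideal (FF n) (P_pos n bar m.+1)`_i.
  by move=> lt_i; apply: P_FF; apply: mem_nth.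
rewrite eS.
apply: (@mc_square_exponent _ _ (lvar n bar Ls m) (lvar n bar Lf m) _ _ _ _
  (fun k => lvar n bar (Lq k) m.+1) (fun k => lvar n bar (Lc k) m)
  (fun k => lvar n bar (Lb k) m) _ (ideal_congruence _) (e_gt0 m)).
- by move=> i; apply: IHm; apply: ltnW.
- exact: (P_FFn 0%N isT).
- exact: (P_FFn 1%N isT).
- exact: (P_FFn 2%N isT).
- exact: (P_FFn 3%N isT).
- exact: (P_FFn 4%N isT).
- exact: (P_FFn 5%N isT).
by apply: P_FF; rewrite mem_cat; apply/orP; right; apply/mapP; exists k.
Qed.

(** Read from [s]: the barred relation of level [n] yields [m1 + m2] factors [b4 true], of which
    [m2] become [b] and [m1] become [b']. The unbarred relation yields as many [b4 false], which
    pair with these to give [c] and [c']. *)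
Lemma CC_relation (n m1 m2 : nat) :
  (m1 + m2 = e n)%N ->
  IdealRes (FF n) 'X_[lcc_mon n 1 m1 m2] 'X_[U_(gidx n Xs)].
Proof.
move=> m12; have cE := ideal_congruence (FF n); have sE := mc_sym cE.
have G_FF i : (i < 7)%N -> in_ideal (FF n) (GG n)`_i.
  by move=> lt_i; apply: in_ideal_gen; rewrite !mem_cat mem_nth ?orbT.
pose l := gvar n Xl; pose s bar := lvar n bar Ls n; pose f bar := lvar n bar Lf n.
pose c := gvar n (Xc false); pose c' := gvar n (Xc true).
pose b := gvar n (Xb false); pose b' := gvar n (Xb true).
pose c4 bar := lvar n bar (Lc k4) n; pose b4 bar := lvar n bar (Lb k4) n.
have -> : 'X_[lcc_mon n 1 m1 m2] = l * c' ^+ m1 * c ^+ m2.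
  by rewrite /lcc_mon !mpolyXD !mpolyXn.
have G1 : IdealRes (FF n) (b4 false * l * b) (l * c).
  exact: (G_FF 0%N isT).
have G2 : IdealRes (FF n) (b4 false * l * b') (l * c').
  exact: (G_FF 1%N isT).
have G3 : IdealRes (FF n) (c4 false * f false) l.
  exact: (G_FF 2%N isT).
have G4 : IdealRes (FF n) (c4 true * f true) (c4 false * s false).
  exact: (G_FF 3%N isT).
have G5 : IdealRes (FF n) (b4 true * c4 false * s false) (c4 false * s false * b).
  exact: (G_FF 4%N isT).
have G6 : IdealRes (FF n) (b4 true * c4 false * s false) (c4 false * s false * b').
  exact: (G_FF 5%N isT).
have G7 : IdealRes (FF n) (c4 true * s true) (gvar n Xs).
  exact: (G_FF 6%N isT).
have it1 : IdealRes (FF n) ((b4 false * b) ^+ m2 * l) (c ^+ m2 * l).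
  by apply: (mc_iter _ cE); rewrite -mulrA (mulrC b) (mulrC c) mulrA.
have it2 : IdealRes (FF n) ((b4 false * b') ^+ m1 * l) (c' ^+ m1 * l).
  by apply: (mc_iter _ cE); rewrite -mulrA (mulrC b') (mulrC c') mulrA.
have it3 : IdealRes (FF n) (b4 true ^+ m2 * (c4 false * s false))
    (b ^+ m2 * (c4 false * s false)).
  by apply: (mc_iter _ cE); rewrite (mulrC b) mulrA.
have it4 : IdealRes (FF n) (b4 true ^+ m1 * (c4 false * s false))
    (b' ^+ m1 * (c4 false * s false)).
  by apply: (mc_iter _ cE); rewrite (mulrC b') mulrA.
have L bar : IdealRes (FF n) (c4 bar * s bar)
    (b4 bar ^+ m1 * b4 bar ^+ m2 * (c4 bar * f bar)).
  by rewrite -exprD m12 mulrA; apply: level_relation.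
apply: (mc_sym cE); rewrite -/(gvar n Xs).
rewrite !exprMn in it1 it2.
clearbody l s f c c' b b' c4 b4.
apply: (mc_step (w := 1) cE (sE _ _ G7)); rewrite ?mul1r //.
apply: (mc_step (w := 1) cE (L true)); rewrite ?mul1r //.
apply: (mc_step (w := b4 true ^+ m1 * b4 true ^+ m2) cE G4) => //.
apply: (mc_step (w := b4 true ^+ m1) cE it3); [by ring | reflexivity |].
apply: (mc_step (w := b ^+ m2) cE it4); [by ring | reflexivity |].
apply: (mc_step (w := b ^+ m2 * b' ^+ m1) cE (L false));
  [by ring | reflexivity |].
apply: (mc_step (w := b ^+ m2 * b' ^+ m1 * b4 false ^+ m1 * b4 false ^+ m2) cE G3);
  [by ring | reflexivity |].
apply: (mc_step (w := b' ^+ m1 * b4 false ^+ m1) cE it1);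
  [by ring | reflexivity |].
apply: (mc_step (w := c ^+ m2) cE it2); [by ring | reflexivity |].
by apply: eq_ind (mc_refl cE _) _ _; ring.
Qed.

(** * Monomials in the three variables of C and D *)

Lemma lcc_monE (n j m1 m2 : nat) (i : 'I_(nvars n)) :
  lcc_mon n j m1 m2 i = ((gidx n Xl == i) * j + (gidx n (Xc true) == i) * m1
    + (gidx n (Xc false) == i) * m2)%N.
Proof. by rewrite /lcc_mon !mnmDE !mulmnE !mnm1E. Qed.

Lemma gidx_eq (n : nat) (v w : global_var) : (gidx n v == gidx n w) = (v == w).
Proof. by rewrite (inj_eq enum_rank_inj). Qed.

Lemma mdeg_lcc_mon (n j m1 m2 : nat) :
  mdeg (lcc_mon n j m1 m2) = (j + m1 + m2)%N.
Proof. by rewrite /lcc_mon !mdegD !mdegMn !mdeg1 !mul1n. Qed.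

Lemma lcc_mon_inj (n j m1 m2 j' m1' m2' : nat) :
  lcc_mon n j m1 m2 = lcc_mon n j' m1' m2' -> m1 = m1'.
Proof.
move/mnmP/(_ (gidx n (Xc true))); rewrite !lcc_monE !gidx_eq /=; lia.
Qed.

Lemma lcc_mon_divisor (n j m1 m2 : nat) (u : 'X_{1..nvars n}) :
  (u <= lcc_mon n j m1 m2)%MM ->
  exists j' m1' m2', [/\ (j' <= j)%N, (m1' <= m1)%N, (m2' <= m2)%N
    & u = lcc_mon n j' m1' m2'].
Proof.
move=> /mnm_lepP le_u.
exists (u (gidx n Xl)), (u (gidx n (Xc true))), (u (gidx n (Xc false))).
have := le_u (gidx n Xl); have := le_u (gidx n (Xc true)).
have := le_u (gidx n (Xc false)); rewrite !lcc_monE !gidx_eq /= => h1 h2 h3.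
split; [lia..|].
apply/mnmP => i; move: (le_u i); rewrite !lcc_monE.
have [<-|_] := eqVneq (gidx n Xl) i; first by rewrite !gidx_eq /=; lia.
have [<-|_] := eqVneq (gidx n (Xc true)) i; first by rewrite !gidx_eq /=; lia.
have [<-|_] := eqVneq (gidx n (Xc false)) i; lia.
Qed.

(** A monomial of C has degree [e n + 1], so a proper divisor meets the bound [e n] of D. *)
Lemma CC_divisor_DD (n : nat) (t u : 'X_{1..nvars n}) :
  in_CC t -> (u <= t)%MM -> u != t -> in_DD u.
Proof.
move=> [m1 [m2 [m12 ->]]] /lcc_mon_divisor[j [a1 [a2 [lej le1 le2 ->]]]] ne.
exists j, a1, a2; split=> //; rewrite leqNgt; apply: contra ne => lt.
by apply/eqP; congr (lcc_mon _ _ _ _); lia.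
Qed.

(** * Highest monomials and hypothesis (ii) *)

Lemma poly_le_mono (N : nat) (le : rel 'X_{1..N}) (t : 'X_{1..N})
    (f : {mpoly 'F_2[N]}) :
  reflexive le -> poly_le le 'X_[t] f -> exists2 t', t' \in msupp f & le t t'.
Proof.
move=> rle; move Dg: 'X_[t] => g lgf; case: lgf Dg => {f g}.
- by move=> f <-; exists t; rewrite ?msuppX ?mem_head.
- by move=> f _ Dg; have := msuppX 'F_2 t; rewrite Dg msupp0.
- move=> g f tg tf [+ _] [tff _] /andP[_ le_tg] Dg.
  by rewrite -Dg msuppX inE => /eqP Dtg; exists tf; rewrite // -Dtg.
- move=> g f u [+ _] [uf _] _ Dg.
  by rewrite -Dg msuppX inE => /eqP <-; exists u.
Qed.

Lemma highest_notin_DD (n : nat) (le : rel 'X_{1..nvars n})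
    (p : {mpoly 'F_2[nvars n]}) (u : 'X_{1..nvars n}) :
  monomial_ordering le ->
  (forall (t : 'X_{1..nvars n}) (f : {mpoly 'F_2[nvars n]}),
     in_DD t -> IdealRes (FF n) 'X_[t] f -> poly_le le 'X_[t] f) ->
  in_ideal (FF n) p -> is_highest le p u -> ~ in_DD u.
Proof.
move=> ole hyp_ii pF [up umax] uD.
have /(poly_le_mono (mo_refl ole))[t] : poly_le le 'X_[u] (p - 'X_[u]).
  by apply: hyp_ii => //; rewrite /IdealRes addrC subrK.
have [<-|ne_ut] := eqVneq u t; rewrite mcoeff_msupp mcoeffB mcoeffX.
  (* A nonzero coefficient in ['F_2] is 1, so subtracting ['X_[u]] removes [u] from the support. *)
  rewrite eqxx => + _; move: up; rewrite mcoeff_msupp.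
  by case: (p@_u) => [[|[|]]].
rewrite (negbTE ne_ut) subr0 -mcoeff_msupp => /umax le_tu le_ut.
by move: ne_ut; rewrite (mo_anti ole (x := u) (y := t)) ?eqxx ?le_ut.
Qed.

(** A function, so that counting its values bounds the number of polynomials; the default is
    returned when no monomial dominates the support. *)
Definition highest (N : nat) (le : rel 'X_{1..N}) (p : {mpoly 'F_2[N]}) :
    'X_{1..N} :=
  head 0%MM [seq t <- msupp p | all (le^~ t) (msupp p)].

Lemma is_highestE (N : nat) (le : rel 'X_{1..N}) (p : {mpoly 'F_2[N]})
    (t : 'X_{1..N}) :
  antisymmetric le -> is_highest le p t -> highest le p = t.
Proof.
move=> ale [tp tmax]; rewrite /highest.
have : t \in [seq t <- msupp p | all (le^~ t) (msupp p)].
  by rewrite mem_filter tp andbT; apply/allP.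
case Ds: [seq _ <- _ | _] => [|u r] //= _.
have /[!mem_filter]/andP[/allP umax up] :
  u \in [seq t <- msupp p | all (le^~ t) (msupp p)] by rewrite Ds mem_head.
by apply: ale; rewrite tmax // umax.
Qed.

Lemma is_highest_binomial (N : nat) (le : rel 'X_{1..N}) (t u : 'X_{1..N}) :
  reflexive le -> mon_lt le u t -> is_highest le ('X_[t] + 'X_[u]) t.
Proof.
move=> rle /andP[/negbTE ne_ut le_ut]; split=> [|t'].
  by rewrite mcoeff_msupp mcoeffD !mcoeffX eqxx ne_ut addr0.
rewrite mcoeff_msupp mcoeffD !mcoeffX.
have [<- _|_] := eqVneq t t'; first exact: rle.
by have [<-|_] := eqVneq u t'; rewrite ?addr0 ?eqxx.
Qed.

Theorem theorem4p1 (n : nat) (le : rel 'X_{1..nvars n})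
    (le_ordering : monomial_ordering le)
    (hyp_i : forall t : 'X_{1..nvars n},
       in_CC t -> mon_lt le U_(gidx n Xs)%MM t)
    (hyp_ii : forall (t : 'X_{1..nvars n}) (f : {mpoly 'F_2[nvars n]}),
       in_DD t -> IdealRes (FF n) 'X_[t] f -> poly_le le 'X_[t] f)
    (Gb : {fset {mpoly 'F_2[nvars n]}})
    (Gb_reduced : is_reduced_groebner_basis le (FF n) Gb) :
  (e n <= #|` Gb|)%N /\
  (e n <= #|` [fset p in Gb | (e n <= total_degree p)%N]%fset|)%N.
Proof.
have [rle ale] := (mo_refl le_ordering, mo_anti le_ordering).
have [[Gb_ideal Gb_lead] _] := Gb_reduced.
have CC_lead t : in_CC t -> exists2 p, p \in Gb & is_highest le p t.
  move=> tC; have [m1 [m2 [m12 Dt]]] := tC.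
  have := CC_relation m12; rewrite -Dt => tF.
  have [p [u [pG pu le_ut]]] :=
    Gb_lead _ _ tF (is_highest_binomial rle (hyp_i _ tC)).
  exists p => //; have [<- //|ne_ut] := eqVneq u t.
  have [pF _] := Gb_ideal p pG.
  by case: (highest_notin_DD le_ordering hyp_ii pF pu (CC_divisor_DD tC le_ut ne_ut)).
set G := [fset p in Gb | _]%fset.
suff le_eG : (e n <= #|` G|)%N.
  by split=> //; apply: (leq_trans le_eG); apply: fsubset_leq_card; apply: fset_sub.
(* C has [e n + 1] elements; the [e n] of them with [m < e n] suffice. *)
pose al m := lcc_mon n 1 m (e n - m).
have al_uniq : uniq [seq al m | m <- iota 0 (e n)].
  by rewrite map_inj_uniq ?iota_uniq // => i j /lcc_mon_inj.
(* These distinct monomials all occur among the values of [highest] on [G]. *)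
rewrite -(size_iota 0 (e n)) -(size_map al).
rewrite -[X in (_ <= X)%N](size_map (highest le) G).
apply: uniq_leq_size => // t /mapP[m /[!mem_iota] /andP[_ lt_me] ->].
have alC : in_CC (al m) by exists m, (e n - m)%N; split=> //; lia.
have [p pG pal] := CC_lead _ alC.
apply/mapP; exists p; last by rewrite (is_highestE ale pal).
rewrite !inE pG /=.
have -> : (e n <= total_degree p)%N; last by [].
(* The degree of [al m] is [e n + 1]. *)
apply: (@leq_trans (mdeg (al m))); first by rewrite mdeg_lcc_mon; lia.
by apply: (leq_bigmax_seq (F := @mdeg _)) => //; case: pal.
Qed.
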